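(* Let $1<p<\infty$, $-\frac1p<\gamma<1-\frac1p$ and $\epsilon>0$. For a complex sequence $g=(g_k)_{k\ge1}$, the operator $H_{g,\gamma}$ is bounded on $\ell^p$ if and only if $\sup_{n\in\mathbb N} G(n;((1+\epsilon)^j);g)<\infty$. Furthermore, $$\|H_{g,\gamma}\|_{\ell^p\to\ell^p}\asymp \sup_{n\in\mathbb N} G(n;((1+\epsilon)^j);g)^{\frac1p},$$ where the implied constants are independent of $g$.
   Context: The operator $H_{g,\gamma}$ maps $a=(a_n)_{n\ge1}\in\ell^p$ to the sequence whose $k$-th entry ($k\in\mathbb N=\{1,2,\dots\}$) is $$\sum_{n=1}^\infty \left(\frac kn\right)^\gamma\frac{g_k a_n}{n+k};$$ it is said to be bounded on $\ell^p$ if it is a bounded operator $\ell^p\to\ell^p$. With $d_j=(1+\epsilon)^j$, $j\ge0$, for $n\in\mathbb N$, $$G(n;((1+\epsilon)^j);g):=\frac1{d_n-d_{n-1}}\sum_{\substack{k\in\mathbb N\\ d_{n-1}\le k<d_n}}|g_k|^p$$ (an empty sum being $0$). The notation $X\asymp Y$, with implied constants independent of $g$, means that there are constants $c,C>0$ not depending on $g$ (they may depend on $p,\gamma,\epsilon$) with $cY\le X\le CY$. *)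

(* Defs.v *)
From mathcomp Require Import all_boot all_order all_algebra.
From mathcomp Require Import all_classical all_reals all_analysis.
From mathcomp Require Import complex.
Set Implicit Arguments.
Unset Strict Implicit.
Unset Printing Implicit Defensive.
Import Order.TTheory GRing.Theory Num.Theory.
Import numFieldNormedType.Exports.
Local Open Scope classical_set_scope.
Local Open Scope ring_scope.
Local Open Scope complex_scope.

(* A complex sequence (a_n)_{n >= 1} is represented by a function
   nat -> R[i] whose value at 0 is irrelevant: every sum, supremum and
   quantifier below ranges over indices >= 1. *)

(* Values in \bar R: the norm is +oo outside l^p. *)
Definition lpnorm (R : realType) (p : R) (a : nat -> R[i]) : \bar R :=
  ((\sum_(1 <= n <oo) ((Normc.normc (a n)) `^ p)%:E) `^ p^-1)%E.

Definition lp (R : realType) (p : R) : set (nat -> R[i]) :=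
  [set a | (lpnorm p a < +oo)%E].

(* The regular algebra R[i]^o is the copy of R[i] carrying the topology of
   the modulus. *)
Definition H_partial (R : realType) (gamma : R) (g a : nat -> R[i])
    (k N : nat) : R[i]^o :=
  \sum_(1 <= n < N)
    ((k%:R / n%:R) `^ gamma)%:C * (g k * a n / (n + k)%:R).

Definition H (R : realType) (gamma : R) (g a : nat -> R[i]) : nat -> R[i] :=
  fun k => limn (H_partial gamma g a k).

(* limn has an arbitrary value on divergent sequences, hence the explicit
   convergence requirement. *)
Definition H_bounded (R : realType) (p gamma : R) (g : nat -> R[i]) : Prop :=
  (forall a, lp p a ->
     (forall k, (1 <= k)%N -> cvgn (H_partial gamma g a k)) /\
     lp p (H gamma g a)) /\
  exists M : R, forall a, lp p a ->
    (lpnorm p (H gamma g a) <= M%:E * lpnorm p a)%E.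

Definition H_opnorm (R : realType) (p gamma : R) (g : nat -> R[i]) : \bar R :=
  ereal_sup [set lpnorm p (H gamma g a) | a in [set a | (lpnorm p a <= 1)%E]].

(* \sum_(k \in A) is a sum over a classical set, equal to 0 by convention when
   infinitely many terms are nonzero; here the index set is bounded. *)
Definition G (R : realType) (p : R) (n : nat) (d : nat -> R)
    (g : nat -> R[i]) : R :=
  (d n - d n.-1)^-1 *
  \sum_(k \in [set k : nat | (1 <= k)%N /\ d n.-1 <= k%:R < d n])
     (Normc.normc (g k)) `^ p.

(* Main.v *)
(* Upper bound: comparing the geometric blocks gives |g_1|^p + ... + |g_M|^p <=
   (1+eps) sup_n G_n M for every M. The Schur test for the kernel
   (k/n)^gamma / (n+k) with the weight n^(-1/p) bounds |H a(k)|^p by |g_k|^p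
   times sum_n k^(t-1) n^(1-t) |a_n|^p / (n+k), up to a constant, where
   t = gamma + 1/p lies in (0,1). Summing over k and exchanging the sums leaves
   sum_k |g_k|^p k^(t-1) / (n+k); as k^(t-1) / (n+k) decreases in k, summation
   by parts replaces |g_k|^p by the constant (1+eps) sup_n G_n.
   Lower bound: for the block [d_(n-1), d_n) test H on the normalised indicator
   of [M, 2M), with M the least integer above d_n; all the arguments of the
   kernel are then comparable to M. *)
Require Import Defs.
From mathcomp Require Import all_boot all_order all_algebra.
From mathcomp Require Import all_classical all_reals all_analysis.
From mathcomp Require Import complex.
From mathcomp Require Import ring lra.
Set Implicit Arguments.
Unset Strict Implicit.
Unset Printing Implicit Defensive.
Import Order.TTheory GRing.Theory Num.Theory.
Import numFieldNormedType.Exports.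
Local Open Scope classical_set_scope.
Local Open Scope ring_scope.

(** * Power sums and the kernel [k^(-t) / (n + k)] *)

Lemma powR_onem_le (R : realType) (x t : R) : 0 <= x <= 1 -> 0 < t < 1 ->
  (1 - x) `^ t <= 1 - t * x.
Proof.
move=> /andP[x0 x1] /andP[t0 t1].
(* Young's inequality for the product of [(1 - x)^t] and 1, with exponents [1/t] and [1/(1 - t)]. *)
have := @conjugate_powR R ((1 - x) `^ t) 1 t^-1 (1 - t)^-1 (powR_ge0 _ _) ler01.
rewrite !invr_gt0 !invrK subr_gt0 addrC subrK => /(_ t0 t1 erefl).
rewrite mulr1 -powRrM mulfV ?gt_eqF// powRr1 ?subr_ge0// powR1.
by lra.
Qed.

(** Discrete form of the integral of [x^(-t)] over [[0, N]]. With [y = N + 1], the Bernoulli-type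
    bound at [x = 1/y] with exponent [1 - t] shows that [y^(1 - t) / (1 - t)] gains at least
    [y^(-t)] over its predecessor. *)
Lemma sum_powRN_le (R : realType) (t : R) (N : nat) : 0 < t < 1 ->
  \sum_(1 <= k < N.+1) k%:R `^ (- t) <= N%:R `^ (1 - t) / (1 - t) :> R.
Proof.
move=> /andP[t0 t1]; have t1' : 0 < 1 - t by rewrite subr_gt0.
elim: N => [|N IH].
  by rewrite big_geq// mulr_ge0 ?powR_ge0// invr_ge0 ltW.
rewrite big_nat_recr//=.
set y : R := N.+1%:R; have y0 : 0 < y by rewrite ltr0n.
have y1 : 1 <= y by rewrite ler1n.
have yN : N%:R = y * (1 - y^-1).
  by rewrite mulrBr mulr1 mulfV ?gt_eqF// /y -natr1 addrK.
have x01 : 0 <= y^-1 <= 1 by rewrite invr_ge0 ltW//= invf_le1.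
have x1 : 0 <= 1 - y^-1 by rewrite subr_ge0; case/andP: x01.
have tt : 0 < 1 - t < 1 by apply/andP; split; lra.
have := powR_onem_le x01 tt.
move: IH; rewrite yN powRM ?(ltW y0)// => IH H.
have e : y `^ (1 - t) = y * y `^ (- t).
  by rewrite -{2}(powRr1 (ltW y0)) -powRD// gt_eqF// implybT.
apply: le_trans (lerD IH (lexx _)) _.
rewrite -lerBrDl -mulrBl ler_pdivlMr// e.
have := ler_wpM2l (ltW y0) H; rewrite mulrBr mulrCA mulfV ?gt_eqF// !mulr1 => H'.
have := ler_wpM2l (powR_ge0 y (- t)) H'; lra.
Qed.

(** Makes the tail sums of [k^(-t-1)] telescope. With [y = N + 1], it amounts to
    [(1 + t/y) (1 - 1/y)^t <= 1], which follows from [(1 + t/y) (1 - t/y) <= 1]. *)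
Lemma powRN_diff_ge (R : realType) (t : R) (N : nat) : 0 < t < 1 -> (0 < N)%N ->
  t * (N.+1%:R `^ (- t) / N.+1%:R) <= N%:R `^ (- t) - N.+1%:R `^ (- t) :> R.
Proof.
move=> t01 N0; have /andP[t0 t1] := t01.
set y : R := N.+1%:R; have y0 : 0 < y by rewrite ltr0n.
have y1 : 1 <= y by rewrite ler1n.
have yN : N%:R = y * (1 - y^-1).
  by rewrite mulrBr mulr1 mulfV ?gt_eqF// /y -natr1 addrK.
have x01 : 0 <= y^-1 <= 1 by rewrite invr_ge0 ltW//= invf_le1.
have x1 : 0 < 1 - y^-1 by rewrite -(pmulr_rgt0 _ y0) -yN ltr0n.
have H := powR_onem_le x01 t01.
have P : 0 < (1 - y^-1) `^ t by rewrite powR_gt0.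
rewrite yN powRM ?(ltW y0) ?(ltW x1)// [(1 - y^-1) `^ (- t)]powRN.
suff : 1 + t / y <= ((1 - y^-1) `^ t)^-1.
  move=> /(ler_wpM2l (powR_ge0 y (- t))); rewrite mulrDr mulr1 mulrCA.
  by rewrite lerBrDl.
rewrite -(ler_pM2r P) mulVf ?gt_eqF//.
have tx : 0 <= t * y^-1 by rewrite mulr_ge0 ?ltW// ?invr_gt0.
have tx0 : 0 <= 1 + t * y^-1 by rewrite addr_ge0.
rewrite mulrC; apply: le_trans (ler_wpM2r tx0 H) _.
by rewrite -subr_sqr expr1n gerBl sqr_ge0.
Qed.

(** Summation by parts done inductively: a partial sum of [v] is nonnegative, so lowering its factor
    from [f k] to [f k.+1] can only decrease the product. *)
Lemma abel_sum_ge (R : realDomainType) (v f : nat -> R) (N : nat) :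
  (forall M, 0 <= \sum_(1 <= k < M.+1) v k) ->
  (forall k, (0 < k)%N -> f k.+1 <= f k) ->
  f N.+1 * \sum_(1 <= k < N.+2) v k <= \sum_(1 <= k < N.+2) v k * f k.
Proof.
move=> v0 fd; elim: N => [|N IH]; first by rewrite !big_nat1 mulrC.
rewrite big_nat_recr//= [leRHS]big_nat_recr//= mulrDr [f _ * v _]mulrC lerD2r.
apply: le_trans IH; rewrite ler_wpM2r//; exact: fd.
Qed.

(** The sum is split at [k = n]. Up to [n] the denominator is at least [n], which yields the term
    [1/(1 - t)]; beyond [n] it is at least [k], which yields [1/t]. *)
Lemma sum_powRN_kernel_le (R : realType) (t : R) (n N : nat) : 0 < t < 1 ->
  (0 < n)%N ->
  \sum_(1 <= k < N) k%:R `^ (- t) / (n + k)%:R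
    <= (t^-1 + (1 - t)^-1) * n%:R `^ (- t) :> R.
Proof.
move=> t01 n0; have /andP[t0 t1] := t01.
have nR : 0 < n%:R :> R by rewrite ltr0n.
have ti : 0 < t^-1 by rewrite invr_gt0.
have small M : (M <= n)%N -> \sum_(1 <= k < M.+1) k%:R `^ (- t) / (n + k)%:R
    <= (1 - t)^-1 * n%:R `^ (- t) :> R.
  move=> Mn; apply: (@le_trans _ _ (\sum_(1 <= k < M.+1) k%:R `^ (- t) / n%:R)).
    apply: ler_sum => k _; rewrite ler_wpM2l ?powR_ge0//.
    by rewrite lef_pV2 ?posrE ?ltr0n ?addn_gt0 ?n0// ler_nat leq_addr.
  rewrite -mulr_suml; apply: le_trans (ler_wpM2r _ (sum_powRN_le M t01)) _.
    by rewrite invr_ge0 ltW.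
  rewrite mulrAC [leRHS]mulrC ler_wpM2r ?invr_ge0 ?subr_ge0 ?(ltW t1)//.
  rewrite ler_pdivrMr// -{2}(powRr1 (ltW nR)) -powRD ?(gt_eqF nR) ?implybT//.
  rewrite [- t + 1]addrC.
  by rewrite ge0_ler_powR ?nnegrE ?ler_nat// subr_ge0 ltW.
(* The subtracted term is what remains of the telescoping tail; it lets the induction on [d]
   close. *)
have large d : \sum_(1 <= k < (n + d).+1) k%:R `^ (- t) / (n + k)%:R
    <= (t^-1 + (1 - t)^-1) * n%:R `^ (- t) - t^-1 * (n + d)%:R `^ (- t) :> R.
  elim: d => [|d IH].
    by rewrite addn0; apply: le_trans (small _ (leqnn n)) _; lra.
  rewrite addnS big_nat_recr//=; apply: le_trans (lerD IH (lexx _)) _.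
  have nd : (0 < n + d)%N by rewrite addn_gt0 n0.
  have := ler_wpM2l (ltW ti) (powRN_diff_ge t01 nd).
  rewrite mulKf ?gt_eqF// => H.
  have aux (c s u v q r : R) :
      r <= s * (u - v) -> q <= r -> c - s * u + q <= c - s * v by lra.
  apply: aux H _; rewrite ler_wpM2l ?powR_ge0//.
  by rewrite lef_pV2 ?posrE ?ltr0n ?addn_gt0 ?n0// ler_nat leq_addl.
case: N => [|N].
  by rewrite big_geq// mulr_ge0 ?powR_ge0// addr_ge0// ?invr_ge0 ?subr_ge0 ltW.
case: (leqP N n) => Nn.
  apply: le_trans (small _ Nn) _; rewrite ler_wpM2r ?powR_ge0//; lra.
rewrite -(subnKC (ltnW Nn)); apply: le_trans (large _) _.
by rewrite gerBl mulr_ge0 ?powR_ge0// ltW.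
Qed.

(* Summation by parts replaces [w] by the constant weight [S]. *)
Lemma sum_weight_kernel_le (R : realType) (t S : R) (w : nat -> R) (n N : nat) :
  0 < t < 1 -> 0 <= S -> (0 < n)%N ->
  (forall M, \sum_(1 <= k < M.+1) w k <= S * M%:R) ->
  \sum_(1 <= k < N) w k * (k%:R `^ (- t) / (n + k)%:R)
    <= S * ((t^-1 + (1 - t)^-1) * n%:R `^ (- t)).
Proof.
move=> t01 S0 n0 wS; have /andP[t0 t1] := t01.
have vE M : \sum_(1 <= k < M.+1) (S - w k) = S * M%:R - \sum_(1 <= k < M.+1) w k.
  by rewrite sumrB sumr_const_nat subn1 mulr_natr.
have f0 k : 0 <= k%:R `^ (- t) / (n + k)%:R :> R.
  by rewrite mulr_ge0 ?powR_ge0// invr_ge0 ler0n.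
(* It remains to see that [S - w k], summed against the kernel, is nonnegative: its partial sums are
   nonnegative by [wS], and the kernel decreases in [k]. *)
apply: le_trans (ler_wpM2l S0 (sum_powRN_kernel_le N t01 n0)).
rewrite mulr_sumr -subr_ge0 -sumrB.
under eq_bigr do rewrite -mulrBl.
case: N => [|[|N]]; try by rewrite big_geq.
apply: le_trans (abel_sum_ge _ _ _).
- by rewrite mulr_ge0// vE subr_ge0.
- by move=> M; rewrite vE subr_ge0.
move=> k k0; apply: ler_pM; rewrite ?powR_ge0 ?invr_ge0 ?ler0n//.
  rewrite !powRN lef_pV2 ?posrE ?powR_gt0 ?ltr0n//.
  by rewrite ge0_ler_powR ?nnegrE ?ler_nat// ltW.
by rewrite lef_pV2 ?posrE ?ltr0n ?addn_gt0 ?n0// ler_nat leq_add2l.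
Qed.

(** * The Schur test for real sequences *)

Lemma powR_sum_weighted_le (R : realType) (p A : R) (u x : nat -> R) (m n : nat) :
  1 < p -> 0 < A -> (forall i, 0 <= u i) -> (forall i, 0 <= x i) ->
  \sum_(m <= i < n) u i <= A ->
  (\sum_(m <= i < n) u i * x i) `^ p
    <= A `^ (p - 1) * \sum_(m <= i < n) u i * x i `^ p.
Proof.
move=> p1 A0 u0 x0 uA.
set B := \sum_(m <= i < n) u i * x i; set D := \sum_(_ <= i < _) _ * _ `^ _.
have p0 : 0 < p by lra.
have B0 : 0 <= B by apply: sumr_ge0 => i _; rewrite mulr_ge0.
pose y := B / A; have y0 : 0 <= y by rewrite divr_ge0// ltW.
have BE : B = y * A by rewrite /y divfK ?gt_eqF.
have yp : y * y `^ (p - 1) = y `^ p by rewrite mulr_powRB1.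
(* Young's inequality against the mean [y], summed over [i]. *)
have Y i : x i * y `^ (p - 1) <= x i `^ p / p + y `^ p * (1 - p^-1).
  have pV : 0 < 1 - p^-1 by rewrite subr_gt0 invf_lt1.
  have := @conjugate_powR R (x i) (y `^ (p - 1)) p (1 - p^-1)^-1 (x0 i)
    (powR_ge0 _ _) p0.
  rewrite invr_gt0 invrK subrKC => /(_ pV erefl).
  by rewrite -powRrM (_ : (p - 1) / (1 - p^-1) = p)//; field; lra.
have : B * y `^ (p - 1) <= D / p + A * (y `^ p * (1 - p^-1)).
  apply: (@le_trans _ _ (\sum_(m <= i < n)
      u i * (x i `^ p / p + y `^ p * (1 - p^-1)))).
    by rewrite mulr_suml; apply: ler_sum => i _; rewrite -mulrA ler_wpM2l.
  under eq_bigr do rewrite mulrDr.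
  rewrite big_split/= lerD//.
    by rewrite /D mulr_suml; apply: ler_sum => i _; rewrite mulrA.
  by rewrite -mulr_suml ler_wpM2r// mulr_ge0 ?powR_ge0// subr_ge0 invf_le1 ?ltW.
(* As [B = y * A], the left side is [A * y^p]; absorbing the share [1 - 1/p] of it from the right
   leaves [A * y^p <= D]. *)
rewrite {1}BE mulrAC yp [A * _]mulrA [A * _]mulrC mulrBr mulr1 => H.
have {}H : y `^ p * A <= D.
  have : y `^ p * A / p <= D / p by lra.
  by rewrite ler_pM2r ?invr_gt0.
rewrite BE powRM ?(ltW A0)// -[A `^ p]mulr_powRB1 ?(ltW A0)//.
by rewrite mulrA mulrC ler_wpM2l ?powR_ge0.
Qed.

(** An upper bound for the integral of [x^(-t) / (1 + x)] over the half-line, split at 1. It is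
    symmetric under [t -> 1 - t], so it serves for the sums over [n] and over [k] alike. *)
Definition schur_const (R : realType) (t : R) : R := t^-1 + (1 - t)^-1.

Lemma schur_const_gt0 (R : realType) (t : R) : 0 < t < 1 -> 0 < schur_const t.
Proof. by case/andP=> t0 t1; rewrite addr_gt0 ?invr_gt0// subr_gt0. Qed.

(** Truncated at [N] so that it grows with [N] and its limit commutes with finite sums over [k]. *)
Definition schur_majorant (R : realType) (p t : R) (a : nat -> R) (k N : nat) : R :=
  schur_const t `^ (p - 1) * (k%:R `^ (t - 1) *
    \sum_(1 <= n < N) n%:R `^ (1 - t) * a n `^ p / (n + k)%:R).

(* Schur test with the weight n^(-1/p). *)
Lemma kernel_sum_powR_le (R : realType) (p gamma : R) (a : nat -> R) (k N : nat) :
  1 < p -> 0 < gamma + p^-1 < 1 -> (forall n, 0 <= a n) -> (0 < k)%N ->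
  (\sum_(1 <= n < N) (k%:R / n%:R) `^ gamma * (a n / (n + k)%:R)) `^ p
    <= schur_majorant p (gamma + p^-1) a k N.
Proof.
move=> p1 t01 a0 k0; set t := gamma + p^-1 in t01 *.
have kR : 0 < k%:R :> R by rewrite ltr0n.
have p0 : 0 < p by lra.
(* The weight [n^(-1/p)] goes into [u] and its inverse into [x]; [u] then has the exponent [-t] that
   the kernel estimate handles, and total mass of order [k^(gamma - t) = k^(-1/p)]. *)
pose u (n : nat) : R := k%:R `^ gamma * (n%:R `^ (- t) / (k + n)%:R).
pose x (n : nat) : R := n%:R `^ p^-1 * a n.
have -> : \sum_(1 <= n < N) (k%:R / n%:R) `^ gamma * (a n / (n + k)%:R)
    = \sum_(1 <= n < N) u n * x n.
  apply: eq_big_nat => n /andP[n0 _].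
  have nR : 0 < n%:R :> R by rewrite ltr0n.
  rewrite /u /x powRM ?invr_ge0 ?ler0n// -powR_inv1 ?ler0n// -powRrM mulN1r.
  have -> : (n%:R : R) `^ (- gamma) = n%:R `^ (- t) * n%:R `^ p^-1.
    by rewrite -powRD ?(gt_eqF nR) ?implybT// /t opprD subrK.
  by rewrite addnC; ring.
have A0 : 0 < schur_const t * k%:R `^ (- p^-1).
  by rewrite mulr_gt0 ?powR_gt0// schur_const_gt0.
have u0 n : 0 <= u n by rewrite !mulr_ge0 ?powR_ge0// invr_ge0 ler0n.
have x0 n : 0 <= x n by rewrite mulr_ge0 ?powR_ge0.
have uA : \sum_(1 <= n < N) u n <= schur_const t * k%:R `^ (- p^-1).
  rewrite -mulr_sumr.
  apply: le_trans (ler_wpM2l (powR_ge0 _ _) (sum_powRN_kernel_le _ t01 k0)) _.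
  have e : gamma - t = - p^-1 by rewrite /t; ring.
  by rewrite mulrCA -powRD ?(gt_eqF kR) ?implybT// e.
apply: le_trans (powR_sum_weighted_le p1 A0 u0 x0 uA) _.
rewrite /schur_majorant powRM ?powR_ge0 ?(ltW (schur_const_gt0 t01))//.
rewrite -mulrA ler_wpM2l ?powR_ge0// -powRrM !mulr_sumr.
rewrite [leLHS]big_nat_cond [leRHS]big_nat_cond.
apply: ler_sum => n; rewrite andbT => /andP[n0 _].
have nR : 0 < n%:R :> R by rewrite ltr0n.
rewrite /u /x powRM ?powR_ge0// -powRrM mulVf ?gt_eqF// powRr1 ?(ltW nR)//.
have -> : (k%:R : R) `^ (t - 1) = k%:R `^ (- p^-1 * (p - 1)) * k%:R `^ gamma.
  rewrite -powRD ?(gt_eqF kR) ?implybT//; congr (_ `^ _).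
  by rewrite /t; field; lra.
have -> : (n%:R : R) `^ (1 - t) = n%:R `^ (- t) * n%:R.
  by rewrite -{3}(powRr1 (ltW nR)) -powRD ?(gt_eqF nR) ?implybT// addrC.
rewrite addnC le_eqVlt; apply/orP; left; apply/eqP; ring.
Qed.

Lemma schur_majorant_homo (R : realType) (p t : R) (a : nat -> R) (k : nat) :
  {homo schur_majorant p t a k : m n / (m <= n)%N >-> m <= n}.
Proof.
move=> m n mn; rewrite /schur_majorant !ler_wpM2l ?powR_ge0//.
case: (leqP 1 m) => m1.
  rewrite [leRHS](big_cat_nat _ mn)//= lerDl sumr_ge0// => i _.
  by rewrite !mulr_ge0 ?powR_ge0// invr_ge0.
rewrite [leLHS]big_geq 1?ltnW// sumr_ge0// => i _.
by rewrite !mulr_ge0 ?powR_ge0// invr_ge0.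
Qed.

(** After the sums are exchanged, the inner sum over [k] is the weighted kernel sum with exponent
    [1 - t]; its bound [n^(t - 1)] cancels the factor [n^(1 - t)]. *)
Lemma sum_schur_majorant_le (R : realType) (p t S : R) (w a : nat -> R)
    (K N : nat) : 1 < p -> 0 < t < 1 -> 0 <= S ->
  (forall M, \sum_(1 <= k < M.+1) w k <= S * M%:R) ->
  \sum_(1 <= k < K) w k * schur_majorant p t a k N
    <= schur_const t `^ p * S * \sum_(1 <= n < N) a n `^ p.
Proof.
move=> p1 t01 S0 wS; have C0 := schur_const_gt0 t01.
have t01' : 0 < 1 - t < 1 by case/andP: t01 => ? ?; apply/andP; split; lra.
have -> : \sum_(1 <= k < K) w k * schur_majorant p t a k N
    = schur_const t `^ (p - 1) * \sum_(1 <= n < N) n%:R `^ (1 - t) * a n `^ p *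
      \sum_(1 <= k < K) w k * (k%:R `^ (- (1 - t)) / (n + k)%:R).
  rewrite mulr_sumr.
  under [RHS]eq_bigr do rewrite !mulr_sumr.
  rewrite [RHS]exchange_big/=; apply: eq_bigr => k _.
  rewrite /schur_majorant !mulr_sumr; apply: eq_bigr => n _.
  by rewrite opprB; ring.
have p0 : 0 < p by lra.
rewrite -[X in X * S]mulr_powRB1 ?(ltW C0)// [schur_const t * _]mulrC -!mulrA.
rewrite ler_wpM2l ?powR_ge0// !mulr_sumr.
rewrite [leLHS]big_nat_cond [leRHS]big_nat_cond.
apply: ler_sum => n; rewrite andbT => /andP[n0 _].
have nR : 0 < n%:R :> R by rewrite ltr0n.
have h0 : 0 <= n%:R `^ (1 - t) * a n `^ p by rewrite mulr_ge0 ?powR_ge0.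
rewrite mulrA.
apply: le_trans (ler_wpM2l h0 (sum_weight_kernel_le _ t01' S0 n0 wS)) _.
rewrite subKr powRN [(1 - t)^-1 + _]addrC -/(schur_const t).
have : n%:R `^ (1 - t) != 0 :> R by rewrite gt_eqF// powR_gt0.
by move=> ?; rewrite le_eqVlt; apply/orP; left; apply/eqP; field.
Qed.

(** The block bounds telescope. Starting at [d 0 = 1] loses nothing, since no index [k >= 1] lies
    below 1. *)
Lemma block_sum_le (R : realType) (d w : nat -> R) (B : R) (N m : nat) :
  d 0%N = 1 ->
  (forall n, \sum_(1 <= k < N | d n <= k%:R < d n.+1) w k <= B * (d n.+1 - d n)) ->
  (forall n, d n <= d n.+1) ->
  \sum_(1 <= k < N | k%:R < d m) w k <= B * (d m - 1).
Proof.
move=> d0 dw dd; elim: m => [|m IH].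
  rewrite d0 subrr mulr0 big_nat_cond big1// => i /andP[/andP[i1 _]].
  by rewrite ltrn1 ltnNge i1.
rewrite (bigID (fun k : nat => k%:R < d m))/=.
rewrite (eq_bigl (fun k : nat => k%:R < d m)); last first.
  move=> k /=; case: (ltP (k%:R : R) (d m)); rewrite ?andbF ?andbT// => H.
  exact: lt_le_trans H (dd m).
rewrite [X in _ + X](eq_bigl (fun k : nat => d m <= k%:R < d m.+1)); last first.
  by move=> k /=; rewrite -leNgt andbC.
by apply: le_trans (lerD IH (dw m)) _; lra.
Qed.

Local Open Scope complex_scope.

(** * Modulus and convergence of complex series *)

Lemma normc_le_ReIm (R : realType) (z : R[i]) :
  Normc.normc z <= `|complex.Re z| + `|complex.Im z|.
Proof.
case: z => a b /=; rewrite -[leRHS]ger0_norm ?addr_ge0// -sqrtr_sqr.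
rewrite ler_sqrt ?sqr_ge0// sqrrD !real_normK ?num_real//.
by have := mulr_ge0 (normr_ge0 a) (normr_ge0 b); lra.
Qed.

Lemma norm_Re_le_normc (R : realType) (z : R[i]) :
  `|complex.Re z| <= Normc.normc z.
Proof.
case: z => a b /=; rewrite -sqrtr_sqr ler_sqrt ?addr_ge0 ?sqr_ge0//.
by rewrite lerDl sqr_ge0.
Qed.

Lemma norm_Im_le_normc (R : realType) (z : R[i]) :
  `|complex.Im z| <= Normc.normc z.
Proof.
case: z => a b /=; rewrite -sqrtr_sqr ler_sqrt ?addr_ge0 ?sqr_ge0//.
by rewrite lerDr sqr_ge0.
Qed.

Lemma cvg_complex (R : realType) (u : nat -> R[i]^o) (x y : R) :
  complex.Re (u n) @[n --> \oo] --> x ->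
  complex.Im (u n) @[n --> \oo] --> y ->
  u n @[n --> \oo] --> (x +i* y : R[i]^o).
Proof.
move=> ux uy; apply/cvgrPdist_lt => -[e e'].
(* The tolerance is a complex number; being positive, it has zero imaginary part. *)
rewrite ltcE/= => /andP[/eqP -> e0].
have e20 : 0 < e / 2 by rewrite divr_gt0.
move/cvgrPdist_lt : ux => /(_ _ e20) ux; move/cvgrPdist_lt : uy => /(_ _ e20) uy.
near=> n.
rewrite -[`|_|]/((Normc.normc (x +i* y - u n))%:C) ltcR.
apply: le_lt_trans (normc_le_ReIm _) _.
rewrite [e](splitr e) ltrD//.
  have : `|x - complex.Re (u n)| < e / 2 by near: n.
  by case: (u n).
have : `|y - complex.Im (u n)| < e / 2 by near: n.
by case: (u n).
Unshelve. all: by end_near. Qed.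

(** Writing [f] as [(f + |f|) - |f|] reduces to nonnegative terms, whose bounded partial sums
    converge by monotonicity. *)
Lemma bounded_sum_is_cvg (R : realType) (f : nat -> R) (M : R) :
  (forall N, \sum_(1 <= n < N) `|f n| <= M) ->
  cvgn (fun N => \sum_(1 <= n < N) f n).
Proof.
move=> fM.
have nnc (h : nat -> R) B : (forall n, 0 <= h n) ->
    (forall N, \sum_(1 <= n < N) h n <= B) ->
    cvgn (fun N => \sum_(1 <= n < N) h n).
  move=> h0 hB; apply: nondecreasing_is_cvgn.
    move=> m n mn; case: (leqP 1 m) => m1.
      by rewrite [leRHS](big_cat_nat _ mn)//= lerDl sumr_ge0.
    by rewrite [leLHS]big_geq 1?ltnW// sumr_ge0.
  by exists B => _ [N _ <-].
have -> : (fun N => \sum_(1 <= n < N) f n) =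
    (fun N => \sum_(1 <= n < N) (f n + `|f n|) - \sum_(1 <= n < N) `|f n|).
  by apply/funext => N; rewrite big_split/= addrK.
apply: is_cvgB; last exact: nnc fM.
apply: (nnc _ (M + M)) => [n|N].
  by rewrite -lerBlDr sub0r lerNnormlW.
rewrite big_split/= lerD//; apply: le_trans (fM N); apply: ler_sum => n _.
exact: ler_norm.
Qed.

Lemma complex_sum_is_cvg (R : realType) (c : nat -> R[i]) (M : R) :
  (forall N, \sum_(1 <= n < N) Normc.normc (c n) <= M) ->
  cvgn (fun N => \sum_(1 <= n < N) c n : R[i]^o).
Proof.
move=> cM.
have ReS N : complex.Re (\sum_(1 <= n < N) c n) =
    \sum_(1 <= n < N) complex.Re (c n).
  by apply: (big_morph (@complex.Re R)) => // -[? ?] [? ?].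
have ImS N : complex.Im (\sum_(1 <= n < N) c n) =
    \sum_(1 <= n < N) complex.Im (c n).
  by apply: (big_morph (@complex.Im R)) => // -[? ?] [? ?].
have cRe : cvgn (fun N => \sum_(1 <= n < N) complex.Re (c n)).
  apply: (bounded_sum_is_cvg (M := M)) => N; apply: le_trans (cM N).
  by apply: ler_sum => n _; exact: norm_Re_le_normc.
have cIm : cvgn (fun N => \sum_(1 <= n < N) complex.Im (c n)).
  apply: (bounded_sum_is_cvg (M := M)) => N; apply: le_trans (cM N).
  by apply: ler_sum => n _; exact: norm_Im_le_normc.
apply/cvg_ex; eexists; apply: cvg_complex.
- by under eq_fun do rewrite ReS; exact: cRe.
- by under eq_fun do rewrite ImS; exact: cIm.
Qed.

Lemma normc_lim_le (R : realType) (u : nat -> R[i]^o) (B : R) :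
  cvgn u -> (forall N, Normc.normc (u N) <= B) -> Normc.normc (limn u) <= B.
Proof.
move=> cu uB; apply/ler_addgt0Pr => e e0.
have eC : 0 < e%:C :> R[i] by rewrite ltcR.
move/cvgrPdist_lt : cu => /(_ _ eC)[N _ /(_ N (leqnn N))].
rewrite -[`|_|]/((Normc.normc (limn u - u N))%:C) ltcR => H.
rewrite -[limn u](subrK (u N)) addrC.
apply: le_trans (le_normcD _ _) _.
by rewrite lerD// ltW.
Qed.

Lemma normc_real (R : realType) (x : R) : Normc.normc x%:C = `|x|.
Proof. by rewrite /= expr0n addr0 sqrtr_sqr. Qed.

Lemma normc_ge0 (R : realType) (z : R[i]) : 0 <= Normc.normc z.
Proof. by case: z => a b; exact: sqrtr_ge0. Qed.

Lemma normc_divn (R : realType) (z : R[i]) (n : nat) :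
  Normc.normc (z / n%:R) = Normc.normc z / n%:R.
Proof.
rewrite Normc.normcM Normc.normcV.
have -> : (n%:R : R[i]) = (n%:R)%:C by rewrite rmorph_nat.
by rewrite normc_real normr_nat.
Qed.

(** * The [l^p] norm and its truncations *)

Lemma lpnorm_ge0 (R : realType) (p : R) (a : nat -> R[i]) : (0 <= lpnorm p a)%E.
Proof. exact: poweR_ge0. Qed.

(** Together with its converse [sum_le_lpnorm], this trades the extended-real norm for real finite
    sums bounded uniformly in the truncation. *)
Lemma lpnorm_le (R : realType) (p M : R) (a : nat -> R[i]) : 0 < p -> 0 <= M ->
  (forall N, \sum_(1 <= n < N) Normc.normc (a n) `^ p <= M `^ p) ->
  (lpnorm p a <= M%:E)%E.
Proof.
move=> p0 M0 aM.
have -> : M%:E = ((M `^ p)%:E `^ p^-1)%E.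
  by rewrite poweR_EFin -powRrM mulfV ?gt_eqF// powRr1.
apply: gt0_ler_poweR; rewrite ?invr_ge0 ?(ltW p0) ?in_itv/= ?leey ?andbT//.
- by apply: nneseries_ge0 => n _ _; rewrite lee_fin powR_ge0.
- by rewrite lee_fin powR_ge0.
apply: lime_le.
  by apply: is_cvg_nneseries => n _ _; rewrite lee_fin powR_ge0.
by apply: nearW => N; rewrite sumEFin lee_fin.
Qed.

Lemma lpnorm_ge_sum (R : realType) (p : R) (a : nat -> R[i]) (N : nat) : 0 < p ->
  (((\sum_(1 <= n < N) Normc.normc (a n) `^ p) `^ p^-1)%:E <= lpnorm p a)%E.
Proof.
move=> p0; rewrite -poweR_EFin.
have s0 : 0 <= \sum_(1 <= n < N) Normc.normc (a n) `^ p.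
  by apply: sumr_ge0 => n _; exact: powR_ge0.
apply: gt0_ler_poweR; rewrite ?invr_ge0 ?(ltW p0) ?in_itv/= ?leey ?andbT//.
  by apply: nneseries_ge0 => n _ _; rewrite lee_fin powR_ge0.
rewrite -sumEFin; apply: nneseries_lim_ge => n _ _.
by rewrite lee_fin powR_ge0.
Qed.

Lemma sum_le_lpnorm (R : realType) (p M : R) (a : nat -> R[i]) (N : nat) :
  0 < p -> (lpnorm p a <= M%:E)%E ->
  \sum_(1 <= n < N) Normc.normc (a n) `^ p <= M `^ p.
Proof.
move=> p0 aM; have := le_trans (lpnorm_ge_sum a N p0) aM.
rewrite lee_fin; set s := \sum_(_ <= _ < _) _ => sM.
have s0 : 0 <= s by apply: sumr_ge0 => n _; exact: powR_ge0.
have M0 : 0 <= M by apply: le_trans sM; exact: powR_ge0.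
rewrite -[s]powRr1// -(mulVf (lt0r_neq0 p0)) powRrM.
by rewrite ge0_ler_powR ?nnegrE ?powR_ge0 ?(ltW p0).
Qed.

(** * Averages over geometric blocks *)

Lemma G_sumE (R : realType) (p : R) (n N : nat) (d : nat -> R) (g : nat -> R[i]) :
  d n <= N%:R -> G p n d g = (d n - d n.-1)^-1 *
    \sum_(1 <= k < N | d n.-1 <= k%:R < d n) Normc.normc (g k) `^ p.
Proof.
move=> dN; rewrite /G; congr (_ * _).
rewrite -[RHS]big_filter; set r := [seq k <- _ | _].
have rE k : (k \in r) = (1 <= k)%N && (d n.-1 <= k%:R < d n).
  rewrite mem_filter mem_index_iota andbC -andbA; congr (_ && _).
  rewrite andbC; case: (boolP (d n.-1 <= k%:R < d n)) => //= /andP[_ kd].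
  by rewrite -(ltr_nat R) (lt_le_trans kd dN).
rewrite (fsbigE r).
- rewrite big_seq_cond [RHS]big_seq_cond; apply: eq_bigl => k.
  rewrite andbT; case: (boolP (k \in r)) => // kr.
  by rewrite mem_set//; move: kr; rewrite rE => /andP.
- exact/filter_uniq/iota_uniq.
- by move=> k /=; rewrite rE => /andP.
- by move=> k /= kA; rewrite rE; case: kA => -> ->.
Qed.

Lemma G_ge0 (R : realType) (p : R) (n : nat) (d : nat -> R) (g : nat -> R[i]) :
  d n.-1 <= d n -> 0 <= G p n d g.
Proof.
move=> dd; rewrite (G_sumE p g (ltW (truncnS_gt _))).
by rewrite mulr_ge0 ?invr_ge0 ?subr_ge0// sumr_ge0// => k _; exact: powR_ge0.
Qed.

Lemma expr1D_unbounded (R : realType) (eps x : R) : 0 < eps ->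
  exists m, x < (1 + eps) ^+ m.
Proof.
move=> e0.
have bern m : 1 + m%:R * eps <= (1 + eps) ^+ m.
  elim: m => [|m IH]; first by rewrite mul0r addr0 expr0.
  have e1 : 0 <= 1 + eps by lra.
  rewrite exprS; apply: le_trans (ler_wpM2l e1 IH).
  have := mulr_ge0 (ler0n R m) (sqr_ge0 eps); rewrite -natr1 expr2; lra.
exists (Num.truncn (x / eps)).+1; apply: lt_le_trans (bern _).
have := truncnS_gt (x / eps); rewrite ltr_pdivrMr//; lra.
Qed.

Lemma sum_g_le (R : realType) (p eps B : R) (g : nat -> R[i]) : 0 < eps -> 0 <= B ->
  (forall n, (0 < n)%N -> G p n (fun j => (1 + eps) ^+ j) g <= B) ->
  forall M, \sum_(1 <= k < M.+1) Normc.normc (g k) `^ p <= (1 + eps) * B * M%:R.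
Proof.
move=> e0 B0 GB [|M]; first by rewrite big_geq// mulr0.
set d := fun j => _ in GB.
have dS n : d n.+1 = (1 + eps) * d n by rewrite /d exprS.
have d0 n : 0 < d n by rewrite exprn_gt0// addr_gt0.
have dd n : d n < d n.+1 by rewrite dS; have := mulr_gt0 e0 (d0 n); lra.
have block N n : \sum_(1 <= k < N | d n <= k%:R < d n.+1) Normc.normc (g k) `^ p
    <= B * (d n.+1 - d n).
  have dn : 0 < d n.+1 - d n by rewrite subr_gt0.
  (* Enlarging the range makes it contain the whole block, so that its sum is the one in [G]. *)
  pose N' := maxn N (Num.truncn (d n.+1)).+1.
  have dN' : d n.+1 <= N'%:R.
    by apply: le_trans (ltW (truncnS_gt _)) _; rewrite ler_nat leq_maxr.
  have := GB n.+1 isT; rewrite (G_sumE p g dN')/= -/(d n) -/(d n.+1).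
  rewrite mulrC ler_pdivrMr//; apply: le_trans.
  case: (leqP 1 N) => N1; last by rewrite big_geq 1?ltnW// sumr_ge0// => *; exact: powR_ge0.
  rewrite [leRHS](big_cat_nat N1 (leq_maxl _ _))//= lerDl.
  by rewrite sumr_ge0// => *; exact: powR_ge0.
(* By minimality the last endpoint [d m] exceeds [M + 1] by a factor of at most [1 + eps], the
   source of this factor in the bound. *)
have [m Mm mmin] := ex_minnP (expr1D_unbounded M.+1%:R e0).
case: m Mm mmin => [|m] Mm mmin; first by move: Mm; rewrite expr0 ltrn1.
have dmM : d m <= M.+1%:R.
  by rewrite leNgt; apply/negP => /mmin; rewrite ltnn.
have -> : \sum_(1 <= k < M.+2) Normc.normc (g k) `^ p =
    \sum_(1 <= k < M.+2 | k%:R < d m.+1) Normc.normc (g k) `^ p.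
  rewrite big_nat_cond [RHS]big_nat_cond; apply: eq_bigl => k.
  rewrite andbT; case: (boolP (1 <= k < M.+2)%N) => //= /andP[_ kM].
  by rewrite (le_lt_trans _ Mm)// ler_nat.
apply: le_trans (block_sum_le m.+1 (expr0 _ : d 0%N = 1) (block _) _) _.
  by move=> n; exact: ltW.
rewrite [_ * B]mulrC -mulrA ler_wpM2l// dS.
have e1 : 0 <= 1 + eps by lra.
have := ler_wpM2l e1 dmM; lra.
Qed.

(** * Upper bound for the operator *)

Section upper.
Variables (R : realType) (p gamma S A : R) (g a : nat -> R[i]).
Hypotheses (p1 : 1 < p) (t01 : 0 < gamma + p^-1 < 1) (S0 : 0 <= S).
Hypothesis gS : forall M, \sum_(1 <= k < M.+1) Normc.normc (g k) `^ p <= S * M%:R.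
Hypothesis A0 : 0 <= A.
Hypothesis aA : forall N, \sum_(1 <= n < N) Normc.normc (a n) `^ p <= A `^ p.

Let C := schur_const (gamma + p^-1).
Let Y := schur_majorant p (gamma + p^-1) (fun n => Normc.normc (a n)).
Let T k N := \sum_(1 <= n < N) (k%:R / n%:R) `^ gamma * (Normc.normc (a n) / (n + k)%:R).

Let p0 : 0 < p. Proof. exact: lt_trans ltr01 p1. Qed.
Let C0 : 0 < C. Proof. exact: schur_const_gt0. Qed.
Let T0 k N : 0 <= T k N.
Proof.
by apply: sumr_ge0 => n _; rewrite mulr_ge0 ?powR_ge0 ?divr_ge0 ?normc_ge0.
Qed.

Lemma schur_majorant_le k N : (0 < k)%N -> Y k N <= C `^ p * A `^ p.
Proof.
move=> k0; apply: le_trans (ler_wpM2l (powR_ge0 C p) (aA N)).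
(* The unit mass at [k] is an admissible weight with [S = 1], so the summed estimate also bounds a
   single majorant. *)
have w1 M : \sum_(1 <= j < M.+1) (j == k)%:R <= 1 * M%:R :> R.
  apply: (@le_trans _ _ (\sum_(1 <= j < M.+1) 1)).
    by apply: ler_sum => j _; case: eqP.
  by rewrite sumr_const_nat subn1 mul1r.
have := sum_schur_majorant_le (fun n => Normc.normc (a n)) k.+1 N p1 t01 ler01 w1.
rewrite mulr1; apply: le_trans.
rewrite big_nat_recr//= eqxx mul1r lerDr sumr_ge0// => j _.
rewrite mulr_ge0// mulr_ge0 ?powR_ge0// mulr_ge0 ?powR_ge0// sumr_ge0// => n _.
by rewrite divr_ge0// mulr_ge0 ?powR_ge0.
Qed.

Lemma normc_term_sumE k N :
  \sum_(1 <= n < N) Normc.normc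
    (((k%:R / n%:R) `^ gamma)%:C * (g k * a n / (n + k)%:R)) =
  Normc.normc (g k) * T k N.
Proof.
rewrite mulr_sumr; apply: eq_bigr => n _.
by rewrite Normc.normcM normc_divn Normc.normcM normc_real ger0_norm ?powR_ge0//; ring.
Qed.

Lemma kernel_sum_le k N : (0 < k)%N -> T k N <= C * A.
Proof.
move=> k0; have TY := kernel_sum_powR_le N p1 t01 (fun n => normc_ge0 (a n)) k0.
have := le_trans TY (schur_majorant_le N k0).
rewrite -powRM ?(ltW C0)// => H; rewrite leNgt; apply/negP => H'.
have : (C * A) `^ p < T k N `^ p.
  by rewrite gt0_ltr_powR ?nnegrE ?mulr_ge0 ?(ltW C0).
by rewrite ltNge H.
Qed.

Lemma H_partial_cvg k : (0 < k)%N -> cvgn (H_partial gamma g a k).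
Proof.
move=> k0; apply: (complex_sum_is_cvg (M := Normc.normc (g k) * (C * A))) => N.
by rewrite normc_term_sumE ler_wpM2l ?normc_ge0// kernel_sum_le.
Qed.

Lemma schur_majorant_cvg k : (0 < k)%N -> cvgn (Y k).
Proof.
move=> k0; apply: nondecreasing_is_cvgn; first exact: schur_majorant_homo.
by exists (C `^ p * A `^ p) => _ [N _ <-]; exact: schur_majorant_le.
Qed.

Lemma normc_H_powR_le k : (0 < k)%N ->
  Normc.normc (H gamma g a k) `^ p <= Normc.normc (g k) `^ p * limn (Y k).
Proof.
move=> k0.
(* By monotonicity the limit dominates every truncation, which gives a bound on the partial sums of
   [H] uniform in [N]. *)
have YL N : Y k N <= limn (Y k).
  apply: nondecreasing_cvgn_le; last exact: schur_majorant_cvg.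
  exact: schur_majorant_homo.
have L0 : 0 <= limn (Y k).
  apply: le_trans (YL 0%N); apply: le_trans (powR_ge0 (T k 0) p) _.
  by apply: kernel_sum_powR_le => // n; exact: normc_ge0.
have H1 : Normc.normc (H gamma g a k) <= Normc.normc (g k) * limn (Y k) `^ p^-1.
  apply: normc_lim_le; first exact: H_partial_cvg.
  move=> N; apply: (@le_trans _ _ (Normc.normc (g k) * T k N)).
    rewrite -normc_term_sumE /H_partial.
    elim/big_rec2: _ => [|n x y _ xy]; first by rewrite Normc.normc0.
    by apply: le_trans (le_normcD _ _) _; rewrite lerD2l.
  rewrite ler_wpM2l ?normc_ge0// -[T k N]powRr1// -(mulfV (lt0r_neq0 p0)) powRrM.
  rewrite ge0_ler_powR ?nnegrE ?powR_ge0 ?invr_ge0 ?(ltW p0)//.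
  apply: le_trans (YL N); apply: kernel_sum_powR_le => // n; exact: normc_ge0.
have := ge0_ler_powR (ltW p0) _ _ H1; rewrite !nnegrE normc_ge0.
rewrite mulr_ge0 ?normc_ge0 ?powR_ge0// => /(_ isT isT) /le_trans; apply.
by rewrite powRM ?normc_ge0 ?powR_ge0// -powRrM mulVf ?gt_eqF// powRr1.
Qed.

(* The limit N -> oo is taken in the majorant, where it is linear. *)
Lemma sum_lim_majorant_le K :
  \sum_(1 <= k < K) Normc.normc (g k) `^ p * limn (Y k) <= C `^ p * S * A `^ p.
Proof.
have cv : \sum_(1 <= k < K) Normc.normc (g k) `^ p * Y k N @[N --> \oo] -->
    \sum_(1 <= k < K) Normc.normc (g k) `^ p * limn (Y k).
  elim: K => [|[|K] IH].
  - by under eq_fun do rewrite big_geq//; rewrite big_geq//; exact: cvg_cst.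
  - by under eq_fun do rewrite big_geq//; rewrite big_geq//; exact: cvg_cst.
  rewrite big_nat_recr//=; under eq_fun do rewrite big_nat_recr//=.
  by apply: cvgD => //; apply: cvgMr; exact: schur_majorant_cvg.
rewrite -(cvg_lim _ cv)//; apply: limr_le; first by apply/cvg_ex; eexists; exact: cv.
apply: nearW => N; apply: le_trans (sum_schur_majorant_le _ K N p1 t01 S0 gS) _.
by rewrite ler_wpM2l// mulr_ge0 ?powR_ge0.
Qed.

Lemma lpnorm_H_le : (lpnorm p (H gamma g a) <= (C * S `^ p^-1 * A)%:E)%E.
Proof.
apply: lpnorm_le => //; first by rewrite !mulr_ge0 ?powR_ge0 ?(ltW C0).
move=> K; rewrite !powRM ?mulr_ge0 ?powR_ge0 ?(ltW C0)//.
rewrite -powRrM mulVf ?gt_eqF// powRr1//.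
apply: le_trans (sum_lim_majorant_le K).
rewrite [leLHS]big_nat_cond [leRHS]big_nat_cond.
apply: ler_sum => k; rewrite andbT => /andP[k0 _]; exact: normc_H_powR_le.
Qed.

End upper.

(** * Lower bound by test sequences *)

Lemma sum_nat_window (R : nmodType) (F : nat -> R) (m n N : nat) :
  (0 < m)%N -> (n <= N)%N ->
  \sum_(1 <= j < N) (if (m <= j < n)%N then F j else 0) = \sum_(m <= j < n) F j.
Proof.
move=> m0 nN; rewrite -big_mkcond/= (big_nat_widenl m 1)// (big_nat_widen _ n N)//=.
Qed.

Section lower.
Variables (R : realType) (p gamma eps : R) (g : nat -> R[i]) (n : nat).
Hypotheses (p1 : 1 < p) (gamma1 : gamma <= 1) (e0 : 0 < eps).

Let d (j : nat) : R := (1 + eps) ^+ j.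
(** The block tested is [[d n, d n.+1)], number [n.+1]. As [d n.+1 >= 1], rounding up at most
    doubles it. The value [h] below gives the [M] entries of the window [p]-th powers of total 1. *)
Let M : nat := (Num.truncn (d n.+1)).+1.
Let h : R := M%:R `^ (- p^-1).
Let a (j : nat) : R[i] := if (M <= j < 2 * M)%N then h%:C else 0.
Let T (k : nat) : R :=
  \sum_(M <= j < 2 * M) (k%:R / j%:R) `^ gamma * (h / (j + k)%:R).

Let p0 : 0 < p. Proof. exact: lt_trans ltr01 p1. Qed.
Let M0 : 0 < M%:R :> R. Proof. by rewrite ltr0n. Qed.
Let h0 : 0 < h. Proof. exact: powR_gt0. Qed.
Let hp : h `^ p = M%:R^-1.
Proof. by rewrite -powRrM mulNr mulVf ?gt_eqF// powR_inv1 ?ltW. Qed.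
Let d1 m : 1 <= d m. Proof. by rewrite exprn_ege1// lerDl ltW. Qed.
Let dM : d n.+1 < M%:R. Proof. exact: truncnS_gt. Qed.
Let Md : M%:R <= 2 * d n.+1.
Proof.
have d0 : 0 <= d n.+1 by exact: le_trans ler01 (d1 _).
have := truncn_le (d n.+1); rewrite d0 => tr.
by rewrite mulr_natl mulr2n -[M%:R]natr1 lerD.
Qed.

Lemma lpnorm_window_le1 : (lpnorm p a <= 1%:E)%E.
Proof.
apply: lpnorm_le => // N; rewrite powR1.
apply: (@le_trans _ _ (\sum_(1 <= j < N + 2 * M) Normc.normc (a j) `^ p)).
  case: (leqP 1 N) => N1.
    rewrite [leRHS](big_cat_nat N1 (leq_addr _ _))//= lerDl.
    by rewrite sumr_ge0// => *; exact: powR_ge0.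
  by rewrite [leLHS]big_geq 1?ltnW// sumr_ge0// => *; exact: powR_ge0.
rewrite (eq_bigr (fun j => if (M <= j < 2 * M)%N then M%:R^-1 else 0)); last first.
  move=> j _; rewrite /a; case: ifPn => _.
    by rewrite normc_real ger0_norm ?(ltW h0).
  by rewrite Normc.normc0 powR0// gt_eqF.
rewrite sum_nat_window ?leq_addl// sumr_const_nat mul2n -addnn addnK.
by rewrite -[leLHS]mulr_natr mulVf ?gt_eqF.
Qed.

Lemma H_windowE k : H gamma g a k = g k * (T k)%:C.
Proof.
apply: (@norm_lim_near_cst _ R[i]^o nat \oo _ _ (H_partial gamma g a k)).
(* From here on the window is exhausted and the partial sums are constant. *)
exists (2 * M)%N => // N /= MN; rewrite /H_partial.
rewrite /T -(@sum_nat_window _ _ M (2 * M) N)//.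
rewrite rmorph_sum/= mulr_sumr; apply: eq_bigr => j _; rewrite /a.
case: ifPn => _; last by rewrite mulr0 mul0r !mulr0.
rewrite !rmorphM/= fmorphV rmorph_nat; ring.
Qed.

(** For [j] in the window, [j <= 2M <= 4 (1 + eps) k] and [j + k <= 3M]. Moreover [k/j <= 1] and
    [gamma <= 1] give [(k/j)^gamma >= k/j], so each of the [M] terms is at least
    [h / (12 (1 + eps) M)]. *)
Lemma window_kernel_ge k : d n <= k%:R < d n.+1 ->
  h / (12 * (1 + eps)) <= T k.
Proof.
move=> /andP[dk kd].
have e1 : 0 < 1 + eps by rewrite addr_gt0.
have k0 : 0 < k%:R :> R by apply: lt_le_trans dk; exact: lt_le_trans ltr01 (d1 _).
have kM : k%:R <= M%:R :> R by apply: ltW; exact: lt_trans kd dM.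
have Mk : M%:R <= 2 * (1 + eps) * k%:R.
  apply: le_trans Md _; rewrite -mulrA ler_wpM2l// /d exprS ler_wpM2l ?(ltW e1)//.
have -> : h / (12 * (1 + eps)) =
    \sum_(M <= j < 2 * M) (4 * (1 + eps))^-1 * (h / (3 * M%:R)).
  rewrite sumr_const_nat mul2n -addnn addnK -[RHS]mulr_natr.
  by field; rewrite !gt_eqF.
rewrite [leLHS]big_nat_cond [leRHS]big_nat_cond.
apply: ler_sum => j; rewrite andbT => /andP[Mj jM].
have jR : 0 < j%:R :> R by rewrite ltr0n (leq_trans _ Mj).
have j2 : j%:R <= 2 * M%:R :> R by rewrite -natrM ler_nat ltnW.
have jMR : M%:R <= j%:R :> R by rewrite ler_nat.
apply: ler_pM.
- by rewrite invr_ge0 mulr_ge0 ?ltW.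
- by rewrite divr_ge0 ?mulr_ge0 ?ltW.
- apply: (@le_trans _ _ (k%:R / j%:R)).
    rewrite ler_pdivlMr// ler_pdivrMl ?mulr_gt0//.
    apply: le_trans j2 _; rewrite (_ : 4 = 2 * 2) -?mulrA ?ler_wpM2l//; last by ring.
    by rewrite mulrA.
  apply: ger1_powR => //; rewrite divr_gt0//= ler_pdivrMr// mul1r.
  exact: le_trans kM jMR.
- rewrite ler_wpM2l ?(ltW h0)// lef_pV2 ?posrE ?mulr_gt0 ?ltr0n ?addn_gt0//; last first.
    by rewrite -!(ltr_nat R) jR.
  have -> : 3 * M%:R = 2 * M%:R + M%:R :> R by ring.
  by rewrite natrD lerD.
Qed.

(** Only the entries in the block are kept. The factor [h^p = 1/M >= 1 / (2 d_(n+1))], compared with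
    the inverse block length [1 / (eps d_n)] in [G], produces [eps / (2 (1 + eps))]. *)
Lemma window_lpnorm_ge :
  (((12 * (1 + eps))^-1 * (eps / (2 * (1 + eps))) `^ p^-1
     * G p n.+1 d g `^ p^-1)%:E <= lpnorm p (H gamma g a))%E.
Proof.
have e1 : 0 < 1 + eps by rewrite addr_gt0.
have c0 : 0 < (12 * (1 + eps))^-1 by rewrite invr_gt0 mulr_gt0.
have dd : 0 < d n.+1 - d n.
  rewrite /d exprS mulrDl mul1r addrC addKr mulr_gt0//.
  exact: lt_le_trans ltr01 (d1 _).
apply: le_trans (lpnorm_ge_sum _ M p0).
have cE : (12 * (1 + eps))^-1 = ((12 * (1 + eps))^-1 `^ p) `^ p^-1.
  by rewrite -powRrM mulfV ?gt_eqF// powRr1// ltW.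
rewrite lee_fin cE.
have G0 : 0 <= G p n.+1 d g by apply: G_ge0; rewrite -subr_ge0 ltW.
have q0 : 0 <= eps / (2 * (1 + eps)) by rewrite divr_ge0 ?mulr_ge0 ?(ltW e0) ?(ltW e1).
rewrite -(powRM _ (powR_ge0 _ _) q0) -(powRM _ (mulr_ge0 (powR_ge0 _ _) q0) G0).
rewrite ge0_ler_powR ?nnegrE ?invr_ge0 ?(ltW p0)//.
- exact: mulr_ge0 (mulr_ge0 (powR_ge0 _ _) q0) G0.
- by rewrite sumr_ge0// => *; exact: powR_ge0.
rewrite (G_sumE p g (ltW dM))/= -/(d n).
set s := \sum_(_ <= _ < _ | _) _.
have s0 : 0 <= s by rewrite sumr_ge0// => *; exact: powR_ge0.
apply: (@le_trans _ _ ((h / (12 * (1 + eps))) `^ p * s)).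
  rewrite powRM ?(ltW h0) ?(ltW c0)// hp mulrA ler_wpM2r//.
  rewrite [leRHS]mulrC -mulrA ler_wpM2l ?powR_ge0//.
  have dE : d n.+1 - d n = eps * d n by rewrite /d exprS; ring.
  have dn0 : 0 < d n by exact: lt_le_trans ltr01 (d1 _).
  rewrite dE; have -> : eps / (2 * (1 + eps)) / (eps * d n) = (2 * d n.+1)^-1.
    by rewrite /d exprS -/(d n); field; rewrite !gt_eqF.
  by rewrite lef_pV2 ?posrE// mulr_gt0// (lt_le_trans ltr01 (d1 _)).
rewrite /s mulr_sumr big_mkcond; apply: ler_sum => k _.
case: ifPn => [kd|_]; last exact: powR_ge0.
rewrite H_windowE Normc.normcM normc_real.
rewrite [leRHS]powRM ?normc_ge0// mulrC ler_wpM2l ?powR_ge0//.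
rewrite ge0_ler_powR ?nnegrE ?(ltW p0) ?divr_ge0 ?mulr_ge0 ?(ltW h0) ?(ltW e1)//.
by apply: le_trans (window_kernel_ge kd) (ler_norm _).
Qed.

End lower.

(** * The two bounds combined *)

Lemma exists_test_sequence (R : realType) (p gamma eps : R) (g : nat -> R[i]) (n : nat) :
  1 < p -> gamma <= 1 -> 0 < eps -> (0 < n)%N ->
  exists2 a : nat -> R[i], (lpnorm p a <= 1%:E)%E &
  (((12 * (1 + eps))^-1 * (eps / (2 * (1 + eps))) `^ p^-1
     * G p n (fun j => (1 + eps) ^+ j) g `^ p^-1)%:E <= lpnorm p (H gamma g a))%E.
Proof.
case: n => // n p1 g1 e0 _; eexists.
  exact: (@lpnorm_window_le1 _ _ eps n).
exact: window_lpnorm_ge.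
Qed.

Lemma H_upper (R : realType) (p gamma eps B A : R) (g a : nat -> R[i]) :
  1 < p -> 0 < gamma + p^-1 < 1 -> 0 < eps -> 0 <= B ->
  (forall n, (0 < n)%N -> G p n (fun j => (1 + eps) ^+ j) g <= B) ->
  (lpnorm p a <= A%:E)%E ->
  (forall k, (0 < k)%N -> cvgn (H_partial gamma g a k)) /\
  (lpnorm p (H gamma g a) <=
    (schur_const (gamma + p^-1) * (1 + eps) `^ p^-1 * B `^ p^-1 * A)%:E)%E.
Proof.
move=> p1 t01 e0 B0 GB aA; have p0 : 0 < p by lra.
have A0 : 0 <= A by rewrite -lee_fin (le_trans (lpnorm_ge0 p a)).
have S0 : 0 <= (1 + eps) * B by rewrite mulr_ge0 ?addr_ge0 ?(ltW e0).
have gS := sum_g_le e0 B0 GB.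
have sa N := sum_le_lpnorm N p0 aA.
split; first by move=> k; exact: H_partial_cvg p1 t01 A0 sa k.
have := lpnorm_H_le p1 t01 S0 gS A0 sa.
by rewrite powRM ?addr_ge0 ?(ltW e0)// !mulrA.
Qed.

Local Close Scope complex_scope.

Theorem corollary1 (R : realType) (p gamma eps : R)
    (hp : 1 < p) (hgamma : - p^-1 < gamma < 1 - p^-1) (heps : 0 < eps) :
  (forall g : nat -> R[i],
     H_bounded p gamma g <->
     (ereal_sup [set (G p n (fun j => (1 + eps) ^+ j) g)%:E
                | n in [set n : nat | (1 <= n)%N]] < +oo)%E) /\
  exists c C : R, 0 < c /\ 0 < C /\
    forall g : nat -> R[i],
      let S := ereal_sup [set ((G p n (fun j => (1 + eps) ^+ j) g) `^ p^-1)%:E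
                         | n in [set n : nat | (1 <= n)%N]] in
      (c%:E * S <= H_opnorm p gamma g)%E /\
      (H_opnorm p gamma g <= C%:E * S)%E.
Proof.
have p0 : 0 < p by lra.
have pV0 : 0 < p^-1 by rewrite invr_gt0.
have e1 : 0 < 1 + eps by rewrite addr_gt0.
have [t01 g1] : 0 < gamma + p^-1 < 1 /\ gamma <= 1.
  by case/andP: hgamma => g1 g2; split; [apply/andP; split|]; lra.
pose C := schur_const (gamma + p^-1) * (1 + eps) `^ p^-1.
have C0 : 0 < C by rewrite mulr_gt0 ?schur_const_gt0 ?powR_gt0.
pose c := (12 * (1 + eps))^-1 * (eps / (2 * (1 + eps))) `^ p^-1.
have c0 : 0 < c by rewrite mulr_gt0 ?invr_gt0 ?powR_gt0 ?divr_gt0 ?mulr_gt0.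
have G0 g n : 0 <= G p n (fun j => (1 + eps) ^+ j) g.
  by apply: G_ge0; rewrite ler_eXn2l ?leq_pred// ltrDl.
have GK g n : G p n (fun j => (1 + eps) ^+ j) g =
    (G p n (fun j => (1 + eps) ^+ j) g `^ p^-1) `^ p.
  by rewrite -powRrM mulVf ?gt_eqF// powRr1.
split=> [g|]; first split.
- move=> [_ [M HM]].
  (* The test sequences give [c * G^(1/p) <= |M|]; the absolute value is taken because [M] has no
     prescribed sign. *)
  apply: (@le_lt_trans _ _ ((`|M| / c) `^ p)%:E); last exact: ltry.
  apply: ge_ereal_sup => _ [n /= n1 <-].
  have [a a1 aH] := exists_test_sequence g hp g1 heps n1.
  have aM : (lpnorm p (H gamma g a) <= `|M|%:E)%E.
    apply: le_trans (HM a _) _; first exact: le_lt_trans a1 (ltry _).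
    apply: (@le_trans _ _ (`|M|%:E * lpnorm p a)%E).
      by rewrite lee_wpmul2r ?lpnorm_ge0// lee_fin ler_norm.
    by rewrite -[leRHS]mule1 lee_wpmul2l// lee_fin.
  have := le_trans aH aM; rewrite lee_fin -/c mulrC -ler_pdivlMr// => H.
  by rewrite lee_fin GK ge0_ler_powR ?nnegrE ?powR_ge0 ?divr_ge0 ?(ltW p0) ?(ltW c0).
- move=> Sfin.
  have [B B0 GB] : exists2 B, 0 <= B &
      forall n, (0 < n)%N -> G p n (fun j => (1 + eps) ^+ j) g <= B.
    have GS n : (0 < n)%N -> ((G p n (fun j => (1 + eps) ^+ j) g)%:E <=
      ereal_sup [set (G p n (fun j => (1 + eps) ^+ j) g)%:E
                | n in [set n : nat | (1 <= n)%N]])%E.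
      by move=> n0; apply: ereal_sup_ubound; exists n.
    (* The value [-oo] is excluded by the entry [n = 1]. *)
    move: Sfin GS; case: (ereal_sup _) => [B _ GS|//|_ /(_ 1%N isT)//].
    exists B => [|n n0]; last by rewrite -lee_fin GS.
    by apply: le_trans (G0 g 1%N) _; rewrite -lee_fin GS.
  have up a A := @H_upper _ p gamma eps B A g a hp t01 heps B0 GB.
  have lpE a : lp p a -> lpnorm p a = (fine (lpnorm p a))%:E.
    by move=> la; rewrite fineK// ge0_fin_numE ?lpnorm_ge0.
  have aA a (la : lp p a) : (lpnorm p a <= (fine (lpnorm p a))%:E)%E by rewrite -lpE.
  split=> [a la|].
    by have [? H] := up _ _ (aA a la); split=> //; exact: le_lt_trans H (ltry _).
  exists (C * B `^ p^-1) => a la; rewrite (lpE a la) -EFinM.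
  by have [_] := up _ _ (aA a la).
exists c, C; split=> //; split=> // g /=; set S := ereal_sup _; split.
  rewrite -lee_pdivlMl//; apply: ge_ereal_sup => _ [n /= n1 <-].
  rewrite lee_pdivlMl// -EFinM.
  have [a a1 aH] := exists_test_sequence g hp g1 heps n1.
  by apply: le_trans aH _; apply: ereal_sup_ubound; exists a.
have GS n : (0 < n)%N -> ((G p n (fun j => (1 + eps) ^+ j) g `^ p^-1)%:E <= S)%E.
  by move=> n0; apply: ereal_sup_ubound; exists n.
(* For [S = +oo] the bound is trivial since [C > 0]; for finite [S = B] the averages are at most
   [B^p]. *)
case: S GS => [B GS| |/(_ 1%N isT)//]; last by rewrite gt0_muley ?leey ?lte_fin.
have B0 : 0 <= B.
  by rewrite -lee_fin; apply: le_trans (GS 1%N isT); rewrite lee_fin powR_ge0.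
have GB n : (0 < n)%N -> G p n (fun j => (1 + eps) ^+ j) g <= B `^ p.
  move=> n0; rewrite GK ge0_ler_powR ?nnegrE ?powR_ge0 ?(ltW p0)//.
  by rewrite -lee_fin GS.
apply: ge_ereal_sup => _ [a /= a1 <-].
have [_] := H_upper hp t01 heps (powR_ge0 B p) GB a1.
by rewrite -powRrM mulfV ?gt_eqF// powRr1// mulr1.
Qed.
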